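(* Let $p>2$ be a prime number and let $G\neq\{e\}$ be a finite $p$-group. Then there exists a characteristic subgroup $N$ of $G$, which is moreover invariant under all surjective endomorphisms of $G$, such that: (1) $\log_2|G:N|\leq f^{b(G)+1}(b(G)\log_2 p)$, where $f^k$ denotes the $k$-th iterate of the function $f(x)=x(x+1)$; (2) $cl(N)\leq b(G)+1$.
   Context: For $x\in G$, $b(x):=\log_p|G:Z_G(x)|$ where $Z_G(x)$ is the centralizer of $x$ in $G$, and $b(G):=\max_{g\in G}b(g)$. $cl(N)$ denotes the nilpotency class of $N$. *)

(* Defs.v *)
From Stdlib Require Import Reals.
From mathcomp Require Import all_boot all_fingroup all_solvable.
Local Open Scope group_scope.
Set Implicit Arguments. Unset Strict Implicit. Unset Printing Implicit Defensive.

Definition bx (p : nat) (gT : finGroupType) (G : {group gT}) (x : gT) : nat :=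
  logn p #|G : 'C_G[x]|.

Definition bG (p : nat) (gT : finGroupType) (G : {group gT}) : nat :=
  \max_(g in G) bx p G g.

Definition log2 (x : R) : R := Rdiv (ln x) (ln 2).

Definition fpoly (x : R) : R := Rmult x (Rplus x 1).

Definition surj_endo_invariant (gT : finGroupType) (G N : {group gT}) : Prop :=
  forall phi : {morphism G >-> gT}, phi @* G = G -> phi @* N \subset N.

(* Main.v *)
Require Import Defs.
From Stdlib Require Import Reals Lra.
From mathcomp Require Import all_boot all_fingroup all_solvable.
Local Open Scope group_scope.

(* Take N = C_G(G'), which has class at most 2 because [N, N] <= G'; when b = 0
   the group is abelian. To bound the index, let x have maximal breadth b and
   choose b elements generating T with G = C_G(x) T. If u centralises T, then
   (u x)^G contains u (x^T) = u (x^G), and equals it by maximality; hence [u, g] lies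
   in X = <x^G> for all g. So V = C_G(x, T) centralises X and is central
   modulo X. As |G : V| <= p^(b(b+1)), some b(b+1) elements generate H with
   G = V H, so G' <= X H' is centralised by C_G(x, T, H). This is the
   centraliser of (b+1)^2 elements, so its index is at most p^(b(b+1)^2), already
   below f^2 of b log_2 p. *)

(** By finiteness a surjective endomorphism is injective, hence an automorphism. *)
Lemma char_surj_endo_invariant (gT : finGroupType) (G N : {group gT}) :
  N \char G -> surj_endo_invariant G N.
Proof.
case/charP=> _ chN phi phiG.
have inj_phi : 'injm phi by rewrite -card_im_injm phiG.
by rewrite chN.
Qed.

Lemma nil_class_cent_der1 (gT : finGroupType) (G : {group gT}) :
  nil_class 'C_G(G^`(1)) <= 2.
Proof.
rewrite nil_class2 subsetI der_sub /=.
apply: subset_trans (dergS 1 (subsetIl _ _)) _.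
by rewrite centsC subsetIr.
Qed.

Lemma index_pgroup (p : nat) (gT : finGroupType) (G H : {group gT}) :
  prime p -> p.-group G -> #|G : H| = (p ^ logn p #|G : H|)%N.
Proof.
move=> pr_p pG.
have /p_natP[m ->] : p.-nat #|G : H| by apply: pnat_dvd (dvdn_indexg _ _) pG.
by rewrite pfactorK.
Qed.

(** Normalisers grow in a [p]-group: each adjoined element is taken in the normaliser of the current
    subgroup but outside it, so it lowers the [p]-logarithm of the index by at least 1. *)
Lemma pgroup_supplement (p : nat) (gT : finGroupType) (G C : {group gT}) :
  prime p -> p.-group G -> C \subset G ->
  exists S : {set gT},
    [/\ S \subset G, #|S| <= logn p #|G : C| & G \subset C * <<S>>].
Proof.
move=> pr_p pG; have [k] := ubnP #|G : C|.
elim: k C => // k IH C; rewrite ltnS => leGk sCG.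
have [sGC | nsGC] := boolP (G \subset C).
  by exists set0; rewrite sub0set cards0 gen0 mulg1.
have prCG : C \proper G by rewrite properE sCG.
have := nilpotent_proper_norm (pgroup_nil pG) prCG.
case/properP=> sCN [x /setIP[Gx Nx] notCx].
pose D := C <*> <[x]>.
have sDG : D \subset G by rewrite join_subG sCG cycle_subG.
have sCD : C \subset D := joing_subl _ _.
have Dx : x \in D by rewrite -cycle_subG joing_subr.
have ltCD : 1 < #|D : C|.
  by rewrite indexg_gt1; apply: contra notCx => /subsetP ->.
have idx : (#|G : D| * #|D : C|)%N = #|G : C| by apply: Lagrange_index.
have ltDG : #|G : D| < k.
  by apply: leq_trans leGk; rewrite -idx ltn_Pmulr ?indexg_gt0.
have [S [sSG cS GS]] := IH _ ltDG sDG.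
exists (x |: S); split.
- by rewrite subUset sub1set Gx.
- rewrite -idx lognM ?indexg_gt0 // addnC.
  apply: leq_trans (leq_card_setU _ _) _; rewrite cards1 leq_add //.
  rewrite lt0n; apply: contraTneq ltCD => log0.
  by rewrite (index_pgroup _ _ _ _ pr_p (pgroupS sDG pG)) log0.
apply: subset_trans GS _.
(* As [x] normalises [C], the join [D] is the plain product of [C] and [<[x]>], and the second
   factor is absorbed into the group generated by [x |: S]. *)
rewrite /D /= norm_joinEr ?cycle_subG // -mulgA mulgS //.
by rewrite mul_subG // genS ?subsetUr // sub1set setU11.
Qed.

Lemma indexI_leq (gT : finGroupType) (G H K : {group gT}) :
  H \subset G -> K \subset G -> #|G : H :&: K| <= (#|G : H| * #|G : K|)%N.
Proof.
move=> sHG sKG; rewrite -(Lagrange_index sHG (subsetIl H K)).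
rewrite leq_pmul2l ?indexg_gt0 // -(leq_pmul2l (cardG_gt0 (H :&: K))).
rewrite Lagrange ?subsetIl // -(leq_pmul2r (cardG_gt0 K)) mul_cardG.
rewrite [leqLHS]mulnC -mulnA leq_pmul2l ?cardG_gt0 // mulnC Lagrange //.
by rewrite subset_leq_card // mul_subG.
Qed.

Lemma class_supplement (gT : finGroupType) (G T : {group gT}) x :
  x \in G -> T \subset G -> G \subset 'C_G[x] * T -> x ^: G = x ^: T.
Proof.
move=> Gx sTG GT; apply/eqP; rewrite eqEsubset andbC imsetS //=.
apply/subsetP=> _ /imsetP[h Gh ->].
have /mulsgP[c t /setIP[_ /cent1P cx] Tt ->] := subsetP GT h Gh.
by rewrite conjgM [x ^ c]conjgE -cx mulKg memJ_class.
Qed.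

Section Breadth.
Variables (p : nat) (gT : finGroupType) (G : {group gT}).
Hypotheses (pr_p : prime p) (pG : p.-group G).

Lemma card_class_bx x : #|x ^: G| = (p ^ bx p G x)%N.
Proof. by rewrite -index_cent1 /bx -index_pgroup. Qed.

Lemma bx_le_bG x : x \in G -> bx p G x <= bG p G.
Proof. by move=> Gx; exact: leq_bigmax_cond. Qed.

Lemma bG_attained : {x | x \in G & bx p G x = bG p G}.
Proof.
have [|x Gx max_x] := @eq_bigmax_cond _ (mem G) (bx p G); last by exists x.
by rewrite cardG_gt0.
Qed.

(** ['C_G(S)] is an intersection of #|S| element centralisers, each of index at most p^b, and
    indices are submultiplicative under intersection. *)
Lemma logn_index_cent (S : {set gT}) :
  S \subset G -> logn p #|G : 'C_G(S)| <= (#|S| * bG p G)%N.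
Proof.
have [k] := ubnP #|S|; elim: k S => // k IH S leSk sSG.
have [-> | [x Sx]] := set_0Vmem S.
  by rewrite (setIidPl _) ?indexgg ?logn1 // -cent_gen gen0 cents1.
rewrite (cardsD1 x) Sx mulnDl mul1n.
have sDG : S :\ x \subset G by apply: subset_trans (subD1set _ _) sSG.
have Gx := subsetP sSG x Sx.
have leS : #|S :\ x| < k by rewrite (cardsD1 x) Sx in leSk.
have eqC : 'C_G(S) = 'C_G[x] :&: 'C_G(S :\ x).
  by rewrite -setIIr -[in LHS](setD1K Sx) centU cent_set1.
apply: leq_trans _ (leq_add (bx_le_bG _ Gx) (IH _ leS sDG)).
rewrite eqC -(leq_exp2l _ _ (prime_gt1 pr_p)) expnD -!index_pgroup //.
exact: indexI_leq (subsetIl _ _) (subsetIl _ _).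
Qed.

Lemma commg_cent_supplement x u g (T : {group gT}) :
    x \in G -> bx p G x = bG p G -> T \subset G -> G \subset 'C_G[x] * T ->
    u \in 'C_G(T) -> g \in G ->
  [~ u, g] \in <<x ^: G>>.
Proof.
move=> Gx bxx sTG GT /setIP[Gu cTu] Gg.
have xGT := class_supplement _ _ _ _ Gx sTG GT.
have sub : u *: (x ^: T) \subset (u * x) ^: G.
  apply/subsetP=> _ /lcosetP[_ /imsetP[t Tt ->] ->].
  have ut : u ^ t = u by apply/conjg_fixP/commgP; exact: (centP cTu).
  by rewrite -{1}ut -conjMg memJ_class // (subsetP sTG).
have eqcl : u *: (x ^: T) = (u * x) ^: G.
  apply/eqP; rewrite eqEcard sub card_lcoset -xGT !card_class_bx bxx.
  by rewrite leq_exp2l ?prime_gt1 // bx_le_bG // groupM.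
(* Writing (u x)^g both as u^g x^g and as u y with y in x^G gives [u, g] = y (x^g)^-1, a quotient of
   two conjugates of x. *)
have : (u * x) ^ g \in u *: (x ^: T) by rewrite eqcl memJ_class.
case/lcosetP=> y; rewrite -xGT => xGy; rewrite conjMg => eq_uy.
have -> : [~ u, g] = y * (x ^ g)^-1.
  by rewrite commgEl; apply: (mulgI u); rewrite mulKVg mulgA -eq_uy mulgK.
by rewrite groupM ?groupV ?mem_gen // memJ_class.
Qed.

Lemma logn_index_cent_der1 :
  logn p #|G : 'C_G(G^`(1))| <= (bG p G * (bG p G).+1 ^ 2)%N.
Proof.
set b := bG p G.
have [x Gx bxx] := bG_attained.
(* [<<S1>>] is the T of the overview, ['C_G(S2)] is V and [<<S3>>] is H. *)
have [S1 [sS1 cS1 GS1]] := pgroup_supplement _ _ _ _ pr_p pG (subsetIl G 'C[x]).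
have {}cS1 : #|S1| <= b by rewrite /b -bxx.
set S2 := x |: S1.
have sS2 : S2 \subset G by rewrite subUset sub1set Gx.
have cS2 : #|S2| <= b.+1.
  by apply: leq_trans (leq_card_setU _ _) _; rewrite cards1 add1n.
have [S3 [sS3 cS3 GS3]] := pgroup_supplement _ _ _ _ pr_p pG (subsetIl G 'C(S2)).
have {}cS3 : #|S3| <= (b.+1 * b)%N.
  by apply: leq_trans cS3 (leq_trans (logn_index_cent _ sS2) _); rewrite leq_mul.
set X := <<x ^: G>>.
have sXG : X \subset G by rewrite gen_subG class_subG.
have nXG : G \subset 'N(X) by rewrite norms_gen // class_norm.
have sVX : [~: 'C_G(S2), G] \subset X.
  rewrite gen_subG; apply/subsetP=> _ /imset2P[u g Vu Gg ->].
  apply: (@commg_cent_supplement x u g <<S1>>%G) => //; rewrite ?gen_subG //.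
  by rewrite /= cent_gen (subsetP (setIS _ (centS (subsetUr _ _))) _ Vu).
(* The generators of X are the x^t with t in [<<S1>>], and V fixes both x and t. *)
have cVX : 'C_G(S2) \subset 'C(X).
  rewrite cent_gen; apply/subsetP=> u /setIP[_ cu].
  have cuS : {in S2, forall y, commute u y} by apply/centP.
  rewrite (class_supplement _ _ <<S1>>%G _ Gx _ GS1) ?gen_subG //.
  apply/centP=> _ /imsetP[t Tt ->].
  have ct : t ^ u = t.
    apply/conjg_fixP/commgP/commute_sym.
    have: u \in 'C(<<S1>>) by rewrite cent_gen (subsetP (centS (subsetUr _ _)) _ cu).
    by move/centP; apply.
  have cx : x ^ u = x.
    by apply/conjg_fixP/commgP/commute_sym/cuS; rewrite setU11.
  by apply/commute_sym/commgP/conjg_fixP; rewrite conjJg ct cx.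
have derG : G^`(1) \subset X * <<S3>>.
  have sHG : <<S3>> \subset G by rewrite gen_subG.
  have sVG : 'C_G(S2) \subset G := subsetIl _ _.
  have cGV : G / X \subset 'C('C_G(S2) / X).
    by rewrite centsC; apply: quotient_cents2r.
  (* Modulo X, G is a central product of V and H; V contributes nothing to the derived subgroup
     since its image is abelian. *)
  have eqG : ('C_G(S2) / X) \* (<<S3>> / X) = G / X.
    rewrite cprodE ?(subset_trans (quotientS _ sHG)) //.
    have eqVH : 'C_G(S2) * <<S3>> = G by apply/eqP; rewrite eqEsubset GS3 mul_subG.
    by rewrite -quotientMl ?(subset_trans sVG) // eqVH.
  have := der_cprod 1 eqG.
  have /derG1P -> : abelian ('C_G(S2) / X).
    by apply: subset_trans (quotientS _ sVG) cGV.
  rewrite cprod1g -!quotient_der ?(subset_trans sHG) // => eq_der.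
  have: G^`(1) / X \subset <<S3>>^`(1) / X by rewrite eq_der.
  have nDX : G^`(1) \subset 'N(X) by apply: subset_trans (der_sub _ _) nXG.
  rewrite quotientSK // => /subset_trans-> //.
  by rewrite mulgS ?der_sub.
have sS : S2 :|: S3 \subset G by rewrite subUset sS2.
have sYC : 'C_G(S2 :|: S3) \subset 'C_G(G^`(1)).
  rewrite subsetI subsetIl centsC (subset_trans derG) // mul_subG //.
    rewrite centsC (subset_trans _ cVX) // setIS // centS // subsetUl //.
  by rewrite gen_subG centsC subIset // centS ?orbT // subsetUr.
apply: leq_trans (dvdn_leq_log _ _ (indexgS _ sYC)) _ => //.
apply: leq_trans (logn_index_cent _ sS) _.
rewrite mulnC leq_mul2l -/b; apply/orP; right.
(* The count of centralised elements is (b+1) + (b+1)b = (b+1)^2. *)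
apply: leq_trans (leq_card_setU _ _) (leq_trans (leq_add cS2 cS3) _).
by rewrite -mulnS expnS expn1.
Qed.

End Breadth.

Lemma log2_INR_expn (n m : nat) :
  0 < n -> log2 (INR (n ^ m)) = Rmult (INR m) (log2 (INR n)).
Proof.
move=> n_gt0; rewrite /log2.
have INR_gt0 k : 0 < k -> Rlt 0 (INR k) by move=> /ltP; apply: lt_0_INR.
have ln_expn : ln (INR (n ^ m)) = Rmult (INR m) (ln (INR n)).
  elim: m => [|m IHm]; first by rewrite /= ln_1 Rmult_0_l.
  rewrite expnS mult_INR ln_mult ?IHm ?S_INR; first by lra.
    exact: INR_gt0.
  by apply: INR_gt0; rewrite expn_gt0 n_gt0.
by rewrite ln_expn; field; have := ln_lt_2; lra.
Qed.

Lemma log2_INR_ge1 (n : nat) : 1 < n -> Rle 1 (log2 (INR n)).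
Proof.
move=> n_gt1; have ln2_gt0 : Rlt 0 (ln 2) by have := ln_lt_2; lra.
have le2n : Rle 2 (INR n) by apply: (le_INR 2); apply/leP.
apply: (Rmult_le_reg_r (ln 2)) => //; rewrite /log2 Rmult_1_l.
rewrite /Rdiv Rmult_assoc Rinv_l ?Rmult_1_r; last by lra.
case: le2n => [lt2n | <-]; last exact: Rle_refl.
by left; apply: ln_increasing; lra.
Qed.

Lemma iter_fpoly_ge (n : nat) (x : R) : Rle 0 x -> Rle x (iter n fpoly x).
Proof.
move=> x_ge0; elim: n => [|n IHn] /=; first exact: Rle_refl.
by apply: Rle_trans IHn _; rewrite /fpoly; nra.
Qed.

(** With y = BL >= B, f(f(y)) = y (y+1) (y^2+y+1), and each of the last two factors is at least
    B+1. *)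
Lemma fpoly2_ge (B L : R) : Rle 0 B -> Rle 1 L ->
  Rle (Rmult (Rmult B (Rmult (Rplus B 1) (Rplus B 1))) L)
      (fpoly (fpoly (Rmult B L))).
Proof.
move=> B_ge0 L_ge1; set y := Rmult B L.
have y_ge : Rle B y by rewrite /y; nra.
have -> : Rmult (Rmult B (Rmult (Rplus B 1) (Rplus B 1))) L
          = Rmult y (Rmult (Rplus B 1) (Rplus B 1)) by rewrite /y; ring.
have -> : fpoly (fpoly y)
          = Rmult y (Rmult (Rplus y 1) (Rplus (Rmult y y) (Rplus y 1))).
  by rewrite /fpoly; ring.
apply: Rmult_le_compat_l; first by lra.
by apply: Rmult_le_compat; nra.
Qed.

Theorem theorem4 (p : nat) (gT : finGroupType) (G : {group gT}) :
  prime p -> 2 < p -> p.-group G -> G :!=: 1%G ->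
  exists N : {group gT},
    [/\ N \char G,
        surj_endo_invariant G N,
        Rle (log2 (INR #|G : N|))
            (iter (bG p G).+1 fpoly (Rmult (INR (bG p G)) (log2 (INR p))))
      & nil_class N <= (bG p G).+1].
Proof.
move=> pr_p p_gt2 pG _.
have chN : 'C_G(G^`(1)) \char G.
  by rewrite subcent_char ?char_refl ?der_char.
exists ('C_G(G^`(1)))%G; split=> //; first exact: char_surj_endo_invariant.
  have le_m := logn_index_cent_der1 _ _ _ pr_p pG.
  have L_ge1 := log2_INR_ge1 _ (prime_gt1 pr_p).
  rewrite (index_pgroup _ _ _ _ pr_p pG) log2_INR_expn ?prime_gt0 //.
  set b := bG p G in le_m *; set L := log2 _ in L_ge1 *; set m := logn p _ in le_m *.
  have b_ge0 := pos_INR b.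
  have y_ge0 : Rle 0 (Rmult (INR b) L) by nra.
  (* For b = 0 only one iterate of f is available, but the index is then 1. Otherwise the two
     innermost iterates suffice, and the remaining ones only increase the value. *)
  case: b le_m b_ge0 y_ge0 => [|b] le_m b_ge0 y_ge0.
    move: le_m; rewrite mul0n leqn0 => /eqP->; rewrite Rmult_0_l.
    by apply: iter_fpoly_ge; apply: Rle_refl.
  rewrite iterSr iterSr; apply: Rle_trans (iter_fpoly_ge b _ _); last first.
    by do 2!(apply: Rle_trans (iter_fpoly_ge 1 _ _)).
  apply: Rle_trans (fpoly2_ge _ _ b_ge0 L_ge1).
  apply: Rmult_le_compat_r; first by lra.
  rewrite -!S_INR -!mult_INR; apply/le_INR/leP.
  by move: le_m; rewrite expnS expn1.
(* Class 2 is too large when b = 0; taking all of G as the centralised set then shows that G is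
   abelian. *)
have [b0 | b_gt0] := posnP (bG p G).
  rewrite b0 nil_class1 (abelianS (subsetIl _ _)) //.
  have := logn_index_cent _ _ G pr_p pG _ (subxx G).
  rewrite b0 muln0 leqn0 => /eqP log0.
  have /eqP := index_pgroup _ _ _ 'C_G(G)%G pr_p pG.
  by rewrite log0 indexg_eq1 subsetI => /andP[].
exact: leq_trans (nil_class_cent_der1 _ _) _.
Qed.
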